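(* For any tree $T$ on at least $3$ vertices and any natural number $n\geq 4$, $$\mathrm{exsat_p}(T,T[n])=(|T|-1)n,$$ where $|T|$ denotes the number of vertices of $T$.
   Context: For a graph $H$ and $n\in\mathbb{N}$, $H[n]$ is the graph obtained from $H$ by replacing each vertex with an independent set (a part) of size $n$ and each edge with a complete bipartite graph between the corresponding parts. A copy of $H$ in $H[n]$ is partite if it has exactly one vertex in each part of $H[n]$. A spanning subgraph $G\subseteq H[n]$ is $(H,H[n])$-partite-extra-saturated if for every edge $uv\in E(H[n])\setminus E(G)$ the graph $G\cup uv$ has more partite copies of $H$ than $G$ ($G$ itself is allowed to contain partite copies of $H$). $\mathrm{exsat_p}(H,H[n])$ is the minimum of $e(G)$ over all $(H,H[n])$-partite-extra-saturated graphs $G$. *)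

(* Defs.v *)
From mathcomp Require Import all_boot.

Set Implicit Arguments.
Unset Strict Implicit.
Unset Printing Implicit Defensive.

Record sgraph := SGraph {
  vertex :> finType;
  adj : rel vertex;
  adj_sym : symmetric adj;
  adj_irrefl : irreflexive adj
}.

(** An edge is encoded as the set of its two endpoints. *)
Definition edges (H : sgraph) : {set {set H}} :=
  [set [set p.1; p.2] | p : H * H & adj p.1 p.2].

Definition connected (H : sgraph) : Prop :=
  0 < #|H| /\ forall x y : H, connect (@adj H) x y.

(** A [ucycle] of length 1 is excluded by irreflexivity, but every edge [xy]
    yields the degenerate [ucycle] [:: x; y]; graph-theoretic cycles are those
    of length at least 3. *)
Definition acyclic (H : sgraph) : Prop :=
  forall c : seq H, ucycle (@adj H) c -> size c < 3.

Definition is_tree (H : sgraph) : Prop := connected H /\ acyclic H.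

Section Blowup.
Variables (H : sgraph) (n : nat).

Definition blowup_adj : rel (H * 'I_n) := fun a b => adj a.1 b.1.

Lemma blowup_adj_sym : symmetric blowup_adj.
Proof. by move=> a b; apply: adj_sym. Qed.

Lemma blowup_adj_irrefl : irreflexive blowup_adj.
Proof. by move=> a; apply: adj_irrefl. Qed.

Definition blowup : sgraph :=
  @SGraph (H * 'I_n)%type blowup_adj blowup_adj_sym blowup_adj_irrefl.

Definition part (v : H) : {set blowup} := [set a : H * 'I_n | a.1 == v].

End Blowup.

(** For a graph on the vertex type [W] with edge set [G]: its copies of [H],
    i.e. its subgraphs [c] (vertex set [c.1], edge set [c.2]) isomorphic to [H].
    Copies are counted as subgraphs, not as embeddings. *)
Definition copies (H : sgraph) (W : finType) (G : {set {set W}}) :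
    {set {set W} * {set {set W}}} :=
  [set c : {set W} * {set {set W}} | (c.2 \subset G) &&
    [exists f : {ffun H -> W},
      [&& injectiveb f,
          c.1 == [set f x | x : H]
        & c.2 == [set [set f x | x in e] | e : {set H} in edges H]]]].

Section PartiteExtraSaturation.
Variables (H : sgraph) (n : nat).

Definition partite_copies (G : {set {set blowup H n}}) :=
  [set c in copies H G | [forall v : H, #|c.1 :&: part n v| == 1]].

(** A spanning subgraph of [blowup H n] is given by its edge set [G]. *)
Definition partite_extra_saturated (G : {set {set blowup H n}}) : bool :=
  (G \subset edges (blowup H n)) &&
  [forall uv in edges (blowup H n) :\: G,
     #|partite_copies G| < #|partite_copies (uv |: G)|].

Lemma blowup_saturated : partite_extra_saturated (edges (blowup H n)).
Proof.
rewrite /partite_extra_saturated subxx /=.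
by apply/forall_inP => uv; rewrite setDv inE.
Qed.

(** By [blowup_saturated] the default value of the [arg min] is admissible, so
    this is a genuine minimum (see [exsatpP]). *)
Definition exsatp : nat :=
  #|[arg min_(G < edges (blowup H n) | partite_extra_saturated G) #|G| ]|.

Lemma exsatpP :
  (exists2 G, partite_extra_saturated G & #|G| = exsatp) /\
  (forall G, partite_extra_saturated G -> exsatp <= #|G|).
Proof.
rewrite /exsatp; case: arg_minnP; first exact: blowup_saturated.
by move=> G satG minG; split; [exists G | exact: minG].
Qed.

End PartiteExtraSaturation.

(* Main.v *)
Require Import Defs.
From mathcomp Require Import all_boot.
From mathcomp Require Import zify.

Set Implicit Arguments.
Unset Strict Implicit.
Unset Printing Implicit Defensive.

(** Write [H] for the tree and call [(x, i)] the vertex number [i] of part [x].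
    A partite copy of [H] in the blow-up is a choice [s x] of one vertex per
    part: [H] has no more edges than the transversal allows, so a copy uses all
    of them ([partite_copy_section]). Hence [G] is saturated iff through every
    missing edge [(x, i)(y, j)] there passes a section whose other edges all
    lie in [G] ([saturatedP]).

    Upper bound. Take [n] disjoint copies of [H], one for each index [i]. Since
    an edge [xy] of a tree is a bridge, the section equal to [i] on the side of
    [x] and to [j] on the side of [y] runs through [(x, i)(y, j)] and otherwise
    stays inside the given copies ([disjoint_copies_saturated]).

    Lower bound, valid for every connected [H] on at least 3 vertices: [G] has
    on average at least [n] edges over each edge of [H]. Suppose fewer than [n]
    lie over [xy]. Then each [(x, i)] misses some [(y, j)], and the section
    through that missing edge gives [(x, i)] a neighbor in every other part [z]
    next to [x]. Moreover a vertex [(x, i)] without neighbors in part [y] lies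
    on no section avoiding a single edge over [xz], so it is joined to all of
    part [z]. There are at least as many such vertices as edges missing from
    the quota [n] over [xy], so the edges over [xz] exceed their own quota by
    enough to compensate ([local_discharge]), even if another deficient edge
    claims compensation at the end [z]. Summing over all edges of [H] gives
    [saturated_card_ge].

    A tree has [#|H| - 1] edges ([card_edges_tree]), which combines the two
    bounds. *)

(** * Edges as two-element sets *)

Lemma eq_set2P (V : finType) (a b c d : V) :
  [set a; b] = [set c; d] -> (a = c /\ b = d) \/ (a = d /\ b = c).
Proof.
move=> E.
have /set2P ac : a \in [set c; d] by rewrite -E; exact: set21.
have /set2P bc : b \in [set c; d] by rewrite -E; exact: set22.
have /set2P ca : c \in [set a; b] by rewrite E; exact: set21.
have /set2P da : d \in [set a; b] by rewrite E; exact: set22.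
by clear E; intuition congruence.
Qed.

Lemma mem_edges (H : sgraph) (a b : H) : ([set a; b] \in edges H) = adj a b.
Proof.
apply/imsetP/idP => [[[c d] /= ] | ab]; last by exists (a, b); rewrite ?inE.
by rewrite inE => /= cd E; case: (eq_set2P E) => -[-> ->] //; rewrite adj_sym.
Qed.

Lemma edgesP (H : sgraph) (e : {set H}) :
  reflect (exists x y, adj x y /\ e = [set x; y]) (e \in edges H).
Proof.
apply: (iffP imsetP) => [[[x y]]|[x [y [xy ->]]]].
  by rewrite inE => xy ->; exists x, y.
by exists (x, y); rewrite ?inE.
Qed.

(** Each edge arises from its two orientations. Counting arcs makes sums over
    edges into double sums over vertices, which is how the discharging below is
    carried out. *)
Lemma handshake (H : sgraph) (E : {set {set H}}) :
  E \subset edges H -> \sum_x \sum_y ([set x; y] \in E) = #|E| * 2.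
Proof.
move=> /subsetP sE; rewrite pair_bigA /= -big_mkcond /=.
rewrite (partition_big (fun p : H * H => [set p.1; p.2]) (mem E)) //=.
rewrite -sum_nat_const; apply: eq_bigr => e eE.
have /edgesP [x [y [xy De]]] := sE _ eE.
have xNy : x != y by apply: contraTneq xy => ->; rewrite adj_irrefl.
rewrite sum1_card -[RHS](_ : #|[set (x, y); (y, x)]| = 2); last first.
  by rewrite cards2 xpair_eqE negb_and xNy.
apply: eq_card => -[a b]; rewrite !inE unfold_in /= !xpair_eqE.
apply/andP/orP => [[_ /eqP]|].
  by rewrite De => /eq_set2P [[-> ->]|[-> ->]]; rewrite !eqxx; auto.
case=> /andP [/eqP-> /eqP->]; first by rewrite -De eqxx.
by rewrite setUC -De eqxx.
Qed.

(** * Partite copies are sections of the blow-up *)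

Section Copies.
Variables (H : sgraph) (n : nat).
Implicit Types (G : {set {set blowup H n}}) (s : H -> 'I_n).

Definition section s (v : H) : blowup H n := (v, s v).

Definition section_copy s : {set blowup H n} * {set {set blowup H n}} :=
  ([set section s v | v : H],
   [set [set section s v | v in e] | e : {set H} in edges H]).

Definition link G (x : H) (i : 'I_n) (y : H) (j : 'I_n) : bool :=
  [set ((x, i) : blowup H n); (y, j)] \in G.

Lemma linkC G x i y j : link G x i y j = link G y j x i.
Proof. by rewrite /link setUC. Qed.

Lemma section_copyP s (a : {set blowup H n}) :
  reflect (exists x y, adj x y /\ a = [set section s x; section s y])
    (a \in (section_copy s).2).
Proof.
apply: (iffP imsetP) => [[e /edgesP [x [y [xy ->]]] ->]|[x [y [xy ->]]]].
  by exists x, y; rewrite imsetU1 imset_set1.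
by exists [set x; y]; rewrite ?mem_edges // imsetU1 imset_set1.
Qed.

Lemma section_copy_partite G s :
  (section_copy s).2 \subset G -> section_copy s \in partite_copies G.
Proof.
move=> sG; rewrite !inE sG /=; apply/andP; split.
  apply/existsP; exists [ffun v => section s v]; apply/and3P; split.
  - by apply/injectiveP => u v; rewrite !ffunE => -[].
  - by apply/eqP/eq_imset => v; rewrite ffunE.
  - apply/eqP/eq_imset => e; apply: eq_imset => v; rewrite ffunE; reflexivity.
apply/forallP => v; rewrite (_ : _ :&: _ = [set section s v]) ?cards1 //.
apply/setP => a; rewrite !inE; apply/andP/eqP => [[/imsetP [u _ ->] /eqP /= ->]|->] //.
by rewrite imset_f //= eqxx.
Qed.

(** If [f] embeds [H] with one vertex in each part, then its projection [pi] to
    [H] is a bijection mapping edges to edges. By finiteness it permutes the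
    edges of [H], so the copy consists of all edges of its transversal. *)
Lemma partite_copy_section G c :
  G \subset edges (blowup H n) -> c \in partite_copies G ->
  exists s, c = section_copy s.
Proof.
move=> /subsetP sG; rewrite !inE => /andP [/andP [/subsetP cG]].
case/existsP=> f /and3P [/injectiveP f_inj /eqP c1 /eqP c2] /forallP c_part.
have c_pick v : exists i, [forall a in c.1, (a.1 == v) ==> (a == (v, i))].
  have /cards1P [[u i] /setP D] := c_part v.
  have := D (u, i); rewrite !inE eqxx /= => /andP [_ /eqP uv].
  exists i; apply/forall_inP => a ac; apply/implyP => av.
  by have := D a; rewrite !inE ac av -uv => /esym.
have /fin_all_exists [s sP] := c_pick.
pose pi x := (f x).1.
have fE x : f x = section s (pi x).
  have fc : f x \in c.1 by rewrite c1 imset_f.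
  by have /forall_inP /(_ _ fc) := sP (pi x); rewrite eqxx => /eqP.
(* [f x] is determined by its part, so injectivity of [f] passes to [pi]. *)
have pi_inj : injective pi.
  by move=> x y E; apply: f_inj; rewrite !fE E.
have pi_edges : [set pi @: e | e : {set H} in edges H] = edges H.
  apply/eqP; rewrite eqEcard (card_imset _ (imset_inj pi_inj)) leqnn andbT.
  apply/subsetP => _ /imsetP [e /edgesP [x [y [xy ->]]] ->].
  rewrite imsetU1 imset_set1 mem_edges.
  have: [set f x; f y] \in edges (blowup H n).
    apply/sG/cG; rewrite c2; apply/imsetP.
    by exists [set x; y]; rewrite ?mem_edges // imsetU1 imset_set1.
  by rewrite mem_edges.
exists s; rewrite [c]surjective_pairing c1 c2; congr (_, _).
  apply/setP => a; apply/imsetP/imsetP => [[x _ ->]|[v _ ->]].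
    by exists (pi x); rewrite ?fE.
  by exists (invF pi_inj v); rewrite // fE f_invF.
rewrite /= -[in RHS]pi_edges -[RHS]imset_comp; apply: eq_imset => e /=.
by rewrite -imset_comp; apply: eq_imset => x; rewrite /= fE.
Qed.

(** Adding edges destroys no copy, so the number of copies grows iff a new one
    appears, and a new copy must use the added edge. *)
Lemma saturatedP G : G \subset edges (blowup H n) ->
  partite_extra_saturated G <->
  (forall x i y j, adj x y -> ~~ link G x i y j ->
   exists s, [/\ s x = i, s y = j & forall u v, adj u v ->
     [set u; v] != [set x; y] -> link G u (s u) v (s v)]).
Proof.
move=> sG; rewrite /partite_extra_saturated sG /=; split.
  move=> /forall_inP sat x i y j xy Nl.
  set uv := [set ((x, i) : blowup H n); (y, j)].
  have uvE : uv \in edges (blowup H n) by rewrite mem_edges.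
  have lt := sat uv; rewrite inE uvE andbT in lt; have {}lt := lt Nl.
  have /subsetPn [c cN cO] : ~~ (partite_copies (uv |: G) \subset partite_copies G).
    by apply: contraL lt => /subset_leq_card; rewrite -leqNgt.
  have sG' : uv |: G \subset edges (blowup H n) by rewrite subUset sub1set uvE.
  have [s Ds] := partite_copy_section sG' cN; subst c.
  have /subsetP cG : (section_copy s).2 \subset uv |: G.
    by move: cN; rewrite !inE => /andP [/andP []].
  have := contra (@section_copy_partite G s) cO => /subsetPn [a /[dup] ac /cG].
  rewrite inE => /orP [/set1P Da|->//] _.
  have [xs ys] : s x = i /\ s y = j.
    have /section_copyP [u [v [_]]] := ac; rewrite Da /uv => E.
    by case: (eq_set2P E) => -[[-> ->] [-> ->]].
  exists s; split=> // u v uvA neq.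
  have: [set section s u; section s v] \in (section_copy s).2.
    by apply/section_copyP; exists u, v.
  move=> /cG; rewrite inE => /orP [/set1P|//].
  by move=> /eq_set2P [[[eu _] [ev _]]|[[eu _] [ev _]]]; case/eqP: neq;
    rewrite eu ev // setUC.
move=> sat; apply/forall_inP => uv; rewrite in_setD => /andP [uvN uvE].
case: (@edgesP (blowup H n) uv uvE) => -[x i] [[y j] [/= xy Duv]].
have Nl : ~~ link G x i y j by rewrite /link -Duv.
have [s [sx sy sP]] := sat x i y j xy Nl.
apply: proper_card; apply/properP; split.
  apply/subsetP => c; rewrite !inE -!andbA => /andP [cG ->].
  by rewrite andbT (subset_trans cG) // subsetUr.
exists (section_copy s).
  apply: section_copy_partite; apply/subsetP => _ /section_copyP [u [v [A ->]]].
  rewrite inE; apply/orP.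
  have [E|neq] := eqVneq [set u; v] [set x; y]; last by right; exact: sP.
  left; rewrite inE Duv /section.
  by case: (eq_set2P E) => -[-> ->]; rewrite sx sy // setUC.
rewrite !inE; apply: contra uvN => /andP [/andP [/subsetP cG _] _]; apply: cG.
by apply/section_copyP; exists x, y; rewrite /section sx sy.
Qed.

End Copies.

(** * Bridges and the number of edges of a tree *)

Lemma adj_connect_sym (H : sgraph) : connect_sym (@adj H).
Proof. by apply: sym_connect_sym; apply: adj_sym. Qed.

Definition del_edge (H : sgraph) (x y : H) : rel H :=
  fun u v => adj u v && ([set u; v] != [set x; y]).

Lemma del_edge_sym (H : sgraph) (x y : H) : symmetric (del_edge x y).
Proof. by move=> u v; rewrite /del_edge adj_sym setUC. Qed.

(** A simple path from [x] to [y] avoiding the edge [xy] would close up with it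
    to a cycle. *)
Lemma acyclic_bridge (H : sgraph) (x y : H) :
  acyclic H -> adj x y -> ~~ connect (del_edge x y) x y.
Proof.
move=> acH xy; apply/negP => /connectP [p pth yl].
case: (shortenP pth) yl => p' pth' p'U _ yl.
have /acH : ucycle (@adj H) (x :: p').
  rewrite /ucycle p'U andbT /= rcons_path -yl adj_sym xy andbT.
  by apply: sub_path pth' => u v /andP [].
case: p' pth' yl {p'U} => [_ Dy|z [|//] /=].
  by rewrite Dy adj_irrefl in xy.
by rewrite andbT => /andP [_ /eqP neq] Dy; case: neq; rewrite Dy.
Qed.

(** A breadth-first spanning tree: [d] is the distance from [r], and the parent
    of [x] is the last vertex before [x] on a shortest path. *)
Lemma connected_parent (H : sgraph) (r : H) : connected H ->
  exists (par : H -> H) (d : H -> nat),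
    forall x, x != r -> adj x (par x) /\ d (par x) < d x.
Proof.
move=> [_ conn].
have ex_d x : exists m,
    [exists p : m.-tuple H, path (@adj H) r p && (last r p == x)].
  have /connectP [p pth xl] := conn r x.
  by exists (size p); apply/existsP; exists (in_tuple p); rewrite pth xl /=.
pose d x := ex_minn (ex_d x).
have step x : exists y, x != r -> adj x y /\ d y < d x.
  have [->|xNr] := eqVneq x r; first by exists r.
  rewrite {2}/d; case: ex_minnP => m /existsP [[p /= /eqP <-]] /andP [].
  case/lastP: p => [_ /eqP Dx|p z]; first by rewrite -Dx eqxx in xNr.
  rewrite rcons_path last_rcons size_rcons => /andP [pth az] /eqP <- _.
  exists (last r p) => _; split; first by rewrite adj_sym.
  rewrite /d; case: ex_minnP => k _; apply; apply/existsP.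
  by exists (in_tuple p); rewrite pth /=.
have /fin_all_exists [par parP] := step.
by exists par, d.
Qed.

(** The edges are the pairs [{x, par x}] with [x] different from the root.
    They are distinct because [d] decreases along [par]. There are no others:
    without an edge [xy] that is not of this form the parent steps would still
    lead from both [x] and [y] to the root, although [xy] is a bridge. *)
Lemma card_edges_tree (H : sgraph) : is_tree H -> #|edges H| = #|H| - 1.
Proof.
move=> [conH acH]; have [/card_gt0P [r _] _] := conH.
have [par [d parP]] := connected_parent r conH.
have -> : edges H = [set [set x; par x] | x in [set~ r]].
  apply/eqP; rewrite eqEsubset; apply/andP; split; apply/subsetP => e; last first.
    by case/imsetP => x; rewrite !inE => /parP [A _] ->; rewrite mem_edges.
  case/edgesP => x [y [xy ->]]; apply: contraT => xyN.
  have to_r u : connect (del_edge x y) r u.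
    have [m] := ubnP (d u); elim: m u => // m IH u du.
    have [->|uNr] := eqVneq u r; first exact: connect0.
    have [A lt] := parP u uNr.
    apply: connect_trans (IH (par u) (leq_trans lt du)) (connect1 _).
    rewrite del_edge_sym /del_edge A; apply: contraNneq xyN => <-.
    by apply/imsetP; exists u; rewrite // !inE.
  have := acyclic_bridge acH xy.
  by rewrite (connect_trans _ (to_r y)) // sym_connect_sym //; exact: del_edge_sym.
rewrite card_in_imset ?cardsC1 ?subn1 // => x y; rewrite !inE => xr yr E.
case: (eq_set2P E) => -[] // Dx Dy.
have [_] := parP x xr; have [_] := parP y yr.
by rewrite Dy -{1}Dx => lt /(ltn_trans lt); rewrite ltnn.
Qed.

(** * The extremal example *)

Section DisjointCopies.
Variables (H : sgraph) (n : nat).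

Definition disjoint_copies : {set {set blowup H n}} :=
  [set [set section (fun=> p.2) v | v in p.1]
    | p : {set H} * 'I_n in setX (edges H) [set: 'I_n]].

Lemma card_disjoint_copies : #|disjoint_copies| <= #|edges H| * n.
Proof. by rewrite (leq_trans (leq_imset_card _ _)) // cardsX cardsT card_ord. Qed.

Lemma link_disjoint_copies x y i :
  adj x y -> link disjoint_copies x i y i.
Proof.
move=> xy; apply/imsetP; exists ([set x; y], i); first by rewrite !inE mem_edges xy.
by rewrite /= imsetU1 imset_set1.
Qed.

(** The two sides of the bridge [xy] can be placed in different copies, since
    they interact only through that edge. *)
Lemma disjoint_copies_saturated :
  acyclic H -> partite_extra_saturated disjoint_copies.
Proof.
move=> acH; apply/saturatedP => [|x i y j xy _].
  apply/subsetP => _ /imsetP [[e i]] /setXP [/edgesP [x [y [xy ->]]] _] ->.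
  by rewrite imsetU1 imset_set1 mem_edges.
(* [C] is the side of [x] after the edge [xy] has been removed. *)
pose C := connect (del_edge x y) x.
exists (fun v => if C v then i else j).
rewrite {1}/C connect0 /C (negbTE (acyclic_bridge acH xy)); split=> // u v uv neq.
have uv' : del_edge x y u v by rewrite /del_edge uv.
have -> : connect (del_edge x y) x u = connect (del_edge x y) x v.
  exact: (same_connect1r (sym_connect_sym (del_edge_sym x y)) uv').
exact: link_disjoint_copies.
Qed.

End DisjointCopies.

(** * The lower bound *)

(** Otherwise [{x, y}] would be a whole connected component. This is what gives
    a deficient edge a neighboring edge that can compensate it. *)
Lemma edge_has_other_neighbor (H : sgraph) (x y : H) :
  connected H -> 2 < #|H| -> adj x y ->
  (exists z, adj x z && (z != y)) \/ (exists z, adj y z && (z != x)).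
Proof.
move=> [_ conn] H3 xy.
have [/existsP|/existsPn Nx] := boolP [exists z, adj x z && (z != y)]; first by left.
have [/existsP|/existsPn Ny] := boolP [exists z, adj y z && (z != x)]; first by right.
have clos : closed (@adj H) [set x; y].
  apply: intro_closed; first exact: adj_connect_sym.
  move=> u v uv /set2P [Du|Du]; subst u.
    by have := Nx v; rewrite uv negbK => /eqP ->; rewrite set22.
  by have := Ny v; rewrite uv negbK => /eqP ->; rewrite set21.
have: #|H| <= #|[set x; y]|.
  apply/subset_leq_card/subsetP => z _.
  by rewrite -(closed_connect clos (conn x z)) set21.
by rewrite cards2; case: eqP H3 => _; case: #|H| => [|[|[]]].
Qed.

Section LowerBound.
Variables (H : sgraph) (n : nat) (G : {set {set blowup H n}}).
Hypothesis sG : G \subset edges (blowup H n).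
Hypothesis satG : partite_extra_saturated G.
Implicit Types (x y z : H) (i j : 'I_n).

Definition ndeg x i y := \sum_j link G x i y j.
Definition weight x y := \sum_i ndeg x i y.
Definition deficit x y := n - weight x y.
Definition full x z := [set i | ndeg x i z == n].
Definition other_deficit x z := \sum_(y | adj x y && (y != z)) deficit x y.

Lemma weightC x y : weight x y = weight y x.
Proof.
rewrite /weight /ndeg exchange_big; apply: eq_bigr => i _; apply: eq_bigr => j _.
by rewrite linkC.
Qed.

Lemma deficitC x y : deficit x y = deficit y x.
Proof. by rewrite /deficit weightC. Qed.

Lemma ndegE x i y : ndeg x i y = #|[set j | link G x i y j]|.
Proof. by rewrite cardsE -sum1_card big_mkcond. Qed.

Lemma sum_weight : \sum_x \sum_(y | adj x y) weight x y = #|G| * 2.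
Proof.
rewrite -(handshake sG).
transitivity (\sum_x \sum_y weight x y).
  apply: eq_bigr => x _; rewrite big_mkcond; apply: eq_bigr => y _.
  case: ifP => // xyN; rewrite /weight /ndeg big1 // => i _; rewrite big1 // => j _.
  apply/eqP; rewrite eqb0; apply/negP => /(subsetP sG).
  by rewrite mem_edges /= /blowup_adj /= xyN.
have pairE (F : blowup H n -> nat) : \sum_a F a = \sum_x \sum_i F (x, i).
  by rewrite (pair_bigA _ (fun x (i : 'I_n) => F (x, i))); apply: eq_bigr => -[].
rewrite pairE; apply: eq_bigr => x _; rewrite exchange_big.
by apply: eq_bigr => i _; rewrite pairE.
Qed.

Lemma ndeg_lt x i y : ndeg x i y < n -> exists j, ~~ link G x i y j.
Proof.
rewrite ndegE => lt; apply/existsP; apply: contraTT lt.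
rewrite negb_exists => /forallP all_l; rewrite -leqNgt -[X in X <= _]card_ord.
by rewrite -cardsT; apply/subset_leq_card/subsetP => j _; rewrite inE -[link _ _ _ _ _]negbK.
Qed.

Lemma ndeg_gt0 x i y j : link G x i y j -> 0 < ndeg x i y.
Proof. by move=> l; rewrite ndegE; apply/card_gt0P; exists j; rewrite inE. Qed.

Lemma section_through x i y j : adj x y -> ~~ link G x i y j ->
  exists s, [/\ s x = i, s y = j & forall u v, adj u v ->
     [set u; v] != [set x; y] -> link G u (s u) v (s v)].
Proof. exact: (proj1 (saturatedP sG)). Qed.

Lemma set2_neq x y z : adj x z -> y != z -> [set x; z] != [set x; y].
Proof.
move=> xz yz; apply: contraNneq yz => /eq_set2P [[_ ->]|[_ Dz]] //.
by rewrite Dz adj_irrefl in xz.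
Qed.

(** With fewer than [n] edges over [xy], the vertex [(x, i)] misses some
    [(y, j)], and the section through this pair has an edge of [G] over [xz]. *)
Lemma deficit_ndeg_gt0 x y z i :
  0 < deficit x y -> adj x y -> adj x z -> y != z -> 0 < ndeg x i z.
Proof.
move=> def xy xz yz.
have [|j Nl] := @ndeg_lt x i y.
  rewrite /deficit subn_gt0 in def; apply: leq_ltn_trans def.
  by rewrite /weight (bigD1 i) //= leq_addr.
have [s [<- _ sP]] := section_through xy Nl.
by apply: ndeg_gt0 (sP x z xz (set2_neq xz yz)).
Qed.

(** A section through a missing edge at [(x, i)] over [xz] would contain an
    edge of [G] from [(x, i)] to part [y]. *)
Lemma isolated_ndeg x y z i :
  ndeg x i y = 0 -> adj x y -> adj x z -> y != z -> ndeg x i z = n.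
Proof.
move=> iso xy xz yz; apply/eqP; rewrite eqn_leq; apply/andP; split.
  by rewrite ndegE -[X in _ <= X]card_ord max_card.
rewrite leqNgt; apply/negP => /ndeg_lt [j Nl].
have [s [Dx _ sP]] := section_through xz Nl.
rewrite eq_sym in yz; have := ndeg_gt0 (sP x y xy (set2_neq xy yz)).
by rewrite Dx iso.
Qed.

Lemma weight_isolated x y : n <= weight x y + #|[set i | ndeg x i y == 0]|.
Proof.
rewrite cardsE -sum1_card [X in _ + X]big_mkcond -big_split /=.
rewrite -[X in X <= _]card_ord -sum1_card; apply: leq_sum => i _.
by rewrite unfold_in /=; case: (ndeg x i y).
Qed.

(** By [weight_isolated] the deficit over [xy] is at most the number of vertices
    of part [x] isolated from part [y], and these are full towards [z]. *)
Lemma deficit_full x y z :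
  adj x y -> adj x z -> y != z -> deficit x y <= #|full x z|.
Proof.
move=> xy xz yz; apply: leq_trans (_ : #|[set i | ndeg x i y == 0]| <= _).
  by rewrite leq_subLR weight_isolated.
apply/subset_leq_card/subsetP => i; rewrite !inE => /eqP iso.
by rewrite (isolated_ndeg iso xy xz yz).
Qed.

(** Deficient edges form a matching: one of them at [x] forces positive degrees,
    hence at least [n] edges, over all the others. *)
Lemma deficit_other0 x y z :
  0 < deficit x y -> adj x y -> adj x z -> y != z -> deficit x z = 0.
Proof.
move=> def xy xz yz; apply/eqP; rewrite subn_eq0 -[X in X <= _]card_ord -sum1_card.
by apply: leq_sum => i _; apply: deficit_ndeg_gt0 def xy xz yz.
Qed.

(** Used with [b = 1], and with [b] the number of full vertices on the other
    side. *)
Lemma weight_full b x z :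
  (forall i, b <= ndeg x i z) -> n * #|full x z| + b * (n - #|full x z|) <= weight x z.
Proof.
move=> minb; rewrite /weight (bigID (mem (full x z))) /=; apply: leq_add.
  rewrite mulnC -sum_nat_const; apply: leq_sum => i; by rewrite inE => /eqP ->.
have -> : n - #|full x z| = #|~: full x z| by rewrite [RHS]cardsCs setCK card_ord.
rewrite mulnC -sum_nat_const.
rewrite [leqRHS](eq_bigl (mem (~: full x z))); first exact: leq_sum.
by move=> i; rewrite /= !inE.
Qed.

(** Since deficient edges form a matching, at most one term of the sum
    [other_deficit x z] is nonzero. *)
Lemma other_deficitP x z : adj x z ->
  other_deficit x z = 0 \/
  [/\ 0 < other_deficit x z, other_deficit x z <= #|full x z|,
      forall i, 0 < ndeg x i z & deficit x z = 0].
Proof.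
move=> xz; have [->|p] := posnP (other_deficit x z); [by left | right].
have [y /and3P [xy yz def]] : exists y, [&& adj x y, y != z & 0 < deficit x y].
  apply/existsP; apply: contraLR p => /existsPn N; rewrite -eqn0Ngt.
  apply/eqP/big1 => y /andP [xy yz]; have := N y; rewrite xy yz /=; lia.
have E : other_deficit x z = deficit x y.
  rewrite /other_deficit (bigD1 y) /= ?xy // big1 ?addn0 // => t /andP [/andP [xt _] ty].
  by apply: deficit_other0 def xy xt _; rewrite eq_sym.
split=> //.
- by rewrite E; apply: deficit_full.
- by move=> i; apply: deficit_ndeg_gt0 def xy xz yz.
- exact: deficit_other0 def xy xz yz.
Qed.

Lemma full_ndeg x z i : #|full z x| <= ndeg x i z.
Proof.
rewrite ndegE; apply/subset_leq_card/subsetP => j; rewrite !inE ndegE => /eqP Dn.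
rewrite linkC; have: [set i | link G z j x i] == setT.
  by rewrite eqEcard subsetT cardsT card_ord Dn leqnn.
by move=> /eqP/setP /(_ i); rewrite !inE.
Qed.

(** Every edge [xz] pays for the deficits of all edges adjacent to it. If
    payments are due at both ends, with [a] and [b] full vertices, the full
    vertices alone give [n * a + (n - a) * b] edges, which is at least
    [n + a + b] because [a] and [b] lie between 1 and [n] and [2 < n]. *)
Lemma local_discharge x z : 2 < n -> adj x z ->
  n + other_deficit x z + other_deficit z x <= weight x z + deficit x z.
Proof.
move=> n3 xz; have zx : adj z x by rewrite adj_sym.
have ax : #|full x z| <= n by rewrite -[X in _ <= X]card_ord max_card.
have az : #|full z x| <= n by rewrite -[X in _ <= X]card_ord max_card.
have W1 b := @weight_full b x z; have W2 b := @weight_full b z x.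
have W3 := weight_full (@full_ndeg x z).
rewrite (weightC z) in W2.
case: (other_deficitP xz) => [->|[p1 le1 /W1 {}W1 d1]];
  case: (other_deficitP zx) => [->|[p2 le2 /W2 {}W2 d2]].
- rewrite /deficit; lia.
- nia.
- nia.
- nia.
Qed.

(** Summing [local_discharge] over all arcs, the total deficit [D] appears on
    the right and the total payment [S + S] on the left. As each deficient edge
    has an adjacent edge, it is paid for at least once at one of its ends, so
    [D <= S + S]. *)
Lemma saturated_card_ge :
  connected H -> 2 < #|H| -> 2 < n -> #|edges H| * n <= #|G|.
Proof.
move=> conH H3 n3; rewrite -(leq_pmul2r (isT : 0 < 2)) mulnAC.
rewrite -(handshake (subxx (edges H))) -sum_weight.
pose D := \sum_x \sum_(y | adj x y) deficit x y.
pose S := \sum_x \sum_(z | adj x z) other_deficit x z.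
have SC : \sum_x \sum_(z | adj x z) other_deficit z x = S.
  rewrite (exchange_big_dep xpredT) //=; apply: eq_bigr => x _.
  by apply: eq_bigl => z; rewrite adj_sym.
have DS : D <= S + S.
  have -> : S = \sum_x \sum_(y | adj x y) \sum_(z | adj x z && (z != y)) deficit x y.
    apply: eq_bigr => x _; rewrite (exchange_big_dep (adj x)) /=; last by move=> z y _ /andP [].
    apply: eq_bigr => y xy; apply: eq_bigl => z; by rewrite xy eq_sym.
  (* Reversing the arcs in the second copy of [S] lets the payments at both
     ends of an edge be added. *)
  have {2}-> : \sum_x \sum_(y | adj x y) \sum_(z | adj x z && (z != y)) deficit x y
      = \sum_x \sum_(y | adj x y) \sum_(z | adj y z && (z != x)) deficit x y.
    rewrite (exchange_big_dep xpredT) //=; apply: eq_bigr => x _.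
    apply: eq_big => y; first by rewrite adj_sym.
    by move=> _; apply: eq_bigr => z _; rewrite deficitC.
  rewrite -big_split /=; apply: leq_sum => x _.
  rewrite -big_split /=; apply: leq_sum => y xy.
  case: (edge_has_other_neighbor conH H3 xy) => -[z zP]; rewrite (bigD1 z zP) /=; lia.
have edgesD : (\sum_(x : H) \sum_(y : H) ([set x; y] \in edges H)) * n
    = \sum_(x : H) \sum_(y | adj x y) n.
  rewrite big_distrl /=; apply: eq_bigr => x _; rewrite big_distrl [RHS]big_mkcond.
  by apply: eq_bigr => y _; rewrite mem_edges /=; case: adj; rewrite ?mul1n.
rewrite edgesD.
have: \sum_x \sum_(z | adj x z) (n + other_deficit x z + other_deficit z x)
   <= \sum_x \sum_(z | adj x z) (weight x z + deficit x z).
  by apply: leq_sum => x _; apply: leq_sum => z; apply: local_discharge.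
have split2 (f g : H -> H -> nat) : \sum_x \sum_(y | adj x y) (f x y + g x y)
    = \sum_x \sum_(y | adj x y) f x y + \sum_x \sum_(y | adj x y) g x y.
  by rewrite -big_split; apply: eq_bigr => x _; rewrite big_split.
rewrite !split2 SC -/S -/D; move: DS; lia.
Qed.

End LowerBound.

Theorem theorem16 (T : sgraph) (n : nat) (T_tree : is_tree T)
  (T_ge3 : 3 <= #|T|) (n_ge4 : 4 <= n) :
  exsatp T n = (#|T| - 1) * n.
Proof.
have [conT acT] := T_tree.
have [[G satG DG] minG] := exsatpP T n.
rewrite -card_edges_tree //; apply/eqP; rewrite eqn_leq; apply/andP; split.
  apply: leq_trans (card_disjoint_copies T n).
  exact/minG/disjoint_copies_saturated.
rewrite -DG; apply: saturated_card_ge => //; last exact: ltnW.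
by have /andP [] := satG.
Qed.
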